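(* Let $s, r \geq 2$ be integers. Then \[ \operatorname{BR}^2(\diamond_s,\diamond_r) \leq \operatorname{BR}^2(\diamond_s, \vee_{s+r-1}) + \left\lceil\log_2(2s+2r)\right\rceil \leq 2\left\lceil\log_{3/2}(2r+2s-1)\right\rceil. \]
   Context: 2-uniform pographs: $\vee_r$ (the $r$-cup) has poset $\{x,y_1,\dots,y_r\}$ with $x\le y_i$ and edges $xy_i$; $\diamond_s$ (the $s$-diamond) has poset $\{x,y_1,\dots,y_s,z\}$ with $x\le y_i\le z$ and edges $xy_i,y_iz$. Given a coloring of the comparable pairs of a poset $Q$, a copy of $H$ in color $i$ is an injection $f:V(H)\to Q$ with $f(x)\le f(y)$ whenever $x\le y$ such that every edge of $H$ is mapped to a pair of color $i$. $\operatorname{BR}^2(G_1,G_2)$ is the least $N$ such that every 2-coloring of the comparable pairs of the Boolean lattice $B_N$ (subsets of $[N]$) contains a copy of $G_1$ in color 1 or a copy of $G_2$ in color 2. *)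

(* Defs.v *)
From HB Require Import structures.
From mathcomp Require Import all_boot all_order all_algebra.
From mathcomp Require Import reals exp.

Set Implicit Arguments.
Unset Strict Implicit.
Unset Printing Implicit Defensive.

Import Order.Theory.
Import preorder.Order.SetSubsetOrder.Exports Order.SetSubsetOrder.Exports.
Local Open Scope order_scope.

(* A 2-uniform pograph. [edge x y] means that the 2-chain {x, y} with x < y is
   an edge, so every edge is listed once, from its lower to its upper end. *)
Record pograph := Pograph {
  pograph_disp : Order.disp_t;
  vertex : finPOrderType pograph_disp;
  edge : rel vertex;
  edge_lt : forall x y, edge x y -> x < y
}.

Inductive cup_vertex (r : nat) := CupBot | CupMid of 'I_r.
Arguments CupBot {r}.
Arguments CupMid {r}.

Section CupVertex.
Variable r : nat.
Implicit Types u v : cup_vertex r.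

Definition cup_code u := if u is CupMid i then Some i else None.
Definition cup_decode o : cup_vertex r := if o is Some i then CupMid i else CupBot.
Lemma cup_codeK : cancel cup_code cup_decode. Proof. by case. Qed.
HB.instance Definition _ := Finite.copy (cup_vertex r) (can_type cup_codeK).

Definition cup_le u v :=
  match u, v with
  | CupBot, _ => true
  | CupMid i, CupMid j => i == j
  | CupMid _, CupBot => false
  end.

Lemma cup_le_refl : reflexive cup_le.
Proof. by case=> //= i. Qed.
Lemma cup_le_anti : antisymmetric cup_le.
Proof. by case=> [|i] [|j] //= /andP[/eqP->]. Qed.
Lemma cup_le_trans : transitive cup_le.
Proof. by case=> [|j] [|i] [|k] //= /eqP-> /eqP->. Qed.

HB.instance Definition _ := Order.Le_isPOrder.Build (Order.Disp tt tt)
  (cup_vertex r) cup_le_refl cup_le_anti cup_le_trans.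

Definition cup_edge u v :=
  match u, v with CupBot, CupMid _ => true | _, _ => false end.

Lemma cup_edge_lt u v : cup_edge u v -> u < v.
Proof. by rewrite lt_neqAle; case: u v => [|i] [|j]. Qed.

Definition cup := Pograph cup_edge_lt.
End CupVertex.

Inductive diamond_vertex (s : nat) := DiaBot | DiaMid of 'I_s | DiaTop.
Arguments DiaBot {s}.
Arguments DiaMid {s}.
Arguments DiaTop {s}.

Section DiamondVertex.
Variable s : nat.
Implicit Types u v : diamond_vertex s.

Definition dia_code u : option (option 'I_s) :=
  match u with
  | DiaBot => None
  | DiaMid i => Some (Some i)
  | DiaTop => Some None
  end.
Definition dia_decode o : diamond_vertex s :=
  match o with
  | None => DiaBot
  | Some (Some i) => DiaMid i
  | Some None => DiaTop
  end.
Lemma dia_codeK : cancel dia_code dia_decode. Proof. by case. Qed.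
HB.instance Definition _ := Finite.copy (diamond_vertex s) (can_type dia_codeK).

Definition dia_le u v :=
  match u, v with
  | DiaBot, _ => true
  | _, DiaTop => true
  | DiaMid i, DiaMid j => i == j
  | _, _ => false
  end.

Lemma dia_le_refl : reflexive dia_le.
Proof. by case=> //= i. Qed.
Lemma dia_le_anti : antisymmetric dia_le.
Proof. by case=> [|i|] [|j|] //= /andP[/eqP->]. Qed.
Lemma dia_le_trans : transitive dia_le.
Proof. by case=> [|j|] [|i|] [|k|] //= /eqP-> /eqP->. Qed.

HB.instance Definition _ := Order.Le_isPOrder.Build (Order.Disp tt tt)
  (diamond_vertex s) dia_le_refl dia_le_anti dia_le_trans.

Definition dia_edge u v :=
  match u, v with
  | DiaBot, DiaMid _ => true
  | DiaMid _, DiaTop => true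
  | _, _ => false
  end.

Lemma dia_edge_lt u v : dia_edge u v -> u < v.
Proof. by rewrite lt_neqAle; case: u v => [|i|] [|j|]. Qed.

Definition diamond := Pograph dia_edge_lt.
End DiamondVertex.

(* A k-coloring of the comparable pairs of Q is given by a function
   c : Q -> Q -> 'I_k, of which only the values c p q with p < q matter:
   these are the only ones that [is_copy] looks at. *)
Definition is_copy (d : Order.disp_t) (Q : porderType d) (k : nat)
    (c : Q -> Q -> 'I_k) (i : 'I_k) (H : pograph) (f : vertex H -> Q) : Prop :=
  [/\ injective f,
      {homo f : x y / x <= y}
    & forall x y, edge x y -> c (f x) (f y) = i].

Definition has_copy (d : Order.disp_t) (Q : porderType d) (k : nat)
    (c : Q -> Q -> 'I_k) (i : 'I_k) (H : pograph) : Prop :=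
  exists f : vertex H -> Q, is_copy c i f.

(* Subsets of [N], ordered by inclusion. *)
Definition boolean_lattice (N : nat) := {subset 'I_N}.

(* Color 1 is ord0 and color 2 is ord_max. *)
Definition boolean_ramsey (G1 G2 : pograph) (N : nat) : Prop :=
  forall c : boolean_lattice N -> boolean_lattice N -> 'I_2,
    has_copy c ord0 G1 \/ has_copy c ord_max G2.

Definition is_BR2 (G1 G2 : pograph) (N : nat) : Prop :=
  boolean_ramsey G1 G2 N /\ forall M, boolean_ramsey G1 G2 M -> (N <= M)%N.

Definition log_base (R : realType) (b x : R) : R := (ln x / ln b)%R.

(* Main.v *)
(* Let k be the ceiling of log_2 (2s + 2r), so that s + r <= 2^(k-1), and write
   N for BR(diamond_s, diamond_r) and N' for BR(diamond_s, cup_(s+r-1)).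

   Colouring a pair A < B blue iff |A| <= l < |B| (plus one more pair) gives
   N' > k with l = 1, and N' > k + 1 with l = 2 if k >= 8.  So it is enough to
   show N <= 2k + 1, and N <= 2k + 2 if k >= 8; N' itself plays no other role.

   For this, suppose that a colouring of the Boolean lattice has no copy.
   Then for any u < w and any colour i, few m between them have u m and m w of
   colour i.  Classify the small sets by the colour of their pair with the
   empty set, the large sets by the colour of their pair with the full set, and
   the sets of a middle level by both (few of these have two equal colours).
   The bound above makes pairs within a class rare, but in every chain
   small < middle < large two of the three sets are in the same class.
   Counting chains gives a contradiction.

   For the second inequality put t = s + r - 1.  Without a red t-cup every set
   has fewer than t red pairs above it; without a blue s-diamond every set has
   fewer than t + s blue pairs below it, by looking at the diamonds whose bottom
   is the empty set.  The n-dimensional lattice has 3^n - 2^n pairs, so this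
   fails as soon as (2t + s - 1) 2^n < 3^n. *)

Require Import Defs.
From Stdlib Require Import BinInt.
From mathcomp Require Import all_boot all_order all_algebra.
From mathcomp Require Import reals exp.
From mathcomp Require Import boolp zify.

Set Implicit Arguments.
Unset Strict Implicit.
Unset Printing Implicit Defensive.

Import Order.Theory GRing.Theory Num.Theory.
Import preorder.Order.SetSubsetOrder.Exports Order.SetSubsetOrder.Exports.

(** * Cardinalities and injections from ordinals *)

Lemma leq_card_inj (T : finType) (A : {set T}) s : s <= #|A| ->
  exists f : 'I_s -> T, injective f /\ forall i, f i \in A.
Proof.
move=> sA; exists (fun i => enum_val (widen_ord sA i)); split=> [i j|i].
  by move/enum_val_inj/(congr1 val)=> /= /val_inj.
exact: enum_valP.
Qed.

Lemma inj_leq_card (T : finType) (A : {set T}) s (f : 'I_s -> T) :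
  injective f -> (forall i, f i \in A) -> s <= #|A|.
Proof.
move=> f_inj fA; rewrite -[s]card_ord -cardsT -(card_imset _ f_inj).
by apply/subset_leq_card/subsetP=> _ /imsetP[i _ ->].
Qed.

(** * Copies of cups and diamonds *)

Section Copies.
Variables (n s : nat) (c : boolean_lattice n -> boolean_lattice n -> 'I_2).
Variable i : 'I_2.
Hypothesis s_gt0 : 0 < s.

Lemma has_copy_cup (x : {set 'I_n}) :
  s <= #|[set y : {set 'I_n} | (x \proper y) && (c x y == i)]| ->
  has_copy c i (cup s).
Proof.
case/leq_card_inj=> f [f_inj f_mem].
have fP j : x \proper f j /\ c x (f j) = i.
  by move: (f_mem j); rewrite inE => /andP[? /eqP].
exists (fun v : cup_vertex s =>
  match v with CupBot => x | CupMid j => f j end : boolean_lattice n).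
split=> [[|j] [|j'] //= | [|j] [|j'] //= | [|j] [|j'] //= _].
- by move=> eq_x; have [] := fP j'; rewrite -eq_x properxx.
- by move=> eq_x; have [] := fP j; rewrite eq_x properxx.
- by move=> /f_inj ->.
- move=> _; rewrite leEsubset; exact: proper_sub (fP j').1.
- by move=> /eqP ->.
- exact: (fP j').2.
Qed.

Lemma has_copy_diamond (x z : {set 'I_n}) :
  s <= #|[set y : {set 'I_n} |
           [&& x \proper y, y \proper z, c x y == i & c y z == i]]| ->
  has_copy c i (diamond s).
Proof.
case/leq_card_inj=> f [f_inj f_mem].
have fP j : [/\ x \proper f j, f j \proper z, c x (f j) = i & c (f j) z = i].
  by move: (f_mem j); rewrite inE => /and4P[? ? /eqP ? /eqP].
have xz : x \proper z.
  by have [+ + _ _] := fP (Ordinal s_gt0); apply: proper_trans.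
exists (fun v : diamond_vertex s => match v with
  | DiaBot => x | DiaMid j => f j | DiaTop => z end : boolean_lattice n).
split.
- case=> [|j|] [|j'|] //= eq_v.
  + by have [] := fP j'; rewrite -eq_v properxx.
  + by move: xz; rewrite eq_v properxx.
  + by have [] := fP j; rewrite eq_v properxx.
  + by rewrite (f_inj _ _ eq_v).
  + by have [_] := fP j; rewrite eq_v properxx.
  + by move: xz; rewrite eq_v properxx.
  + by have [_] := fP j'; rewrite -eq_v properxx.
- case=> [|j|] [|j'|] //= le_v; rewrite leEsubset.
  + by have [/proper_sub] := fP j'.
  + exact: proper_sub.
  + by rewrite (eqP (le_v : j == j')).
  + by have [_ /proper_sub] := fP j.
- by case=> [|j|] [|j'|] //= _; [have [] := fP j' | have [] := fP j].
Qed.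

End Copies.

(** * Counting chains small < middle < large *)

Lemma sum_card_exchange (T U : finType) (A : {set T}) (B : {set U})
    (e : T -> U -> bool) :
  \sum_(x in A) #|[set y in B | e x y]| = \sum_(y in B) #|[set x in A | e x y]|.
Proof.
under eq_bigr do rewrite -sum1dep_card.
under [RHS]eq_bigr do rewrite -sum1dep_card.
rewrite (exchange_big_dep (mem B)) //= => [|x y _ /andP[] //].
by apply: eq_bigr => y yB; apply: eq_bigl => x; rewrite yB.
Qed.

Lemma leq_sum_card (T : finType) (A : {set T}) (f : T -> nat) m :
  (forall x, x \in A -> f x <= m) -> \sum_(x in A) f x <= m * #|A|.
Proof. by move=> le_fm; rewrite mulnC -sum_nat_const; apply: leq_sum. Qed.

Lemma leq_card_split (T : finType) (A B : {set T}) (p : pred T) m :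
    [set x in A | p x] \subset B -> #|B| <= m ->
  #|A| <= m + #|[set x in A | ~~ p x]|.
Proof.
move=> /subset_leq_card AB Bm; rewrite -(cardsID [set x | p x] A).
rewrite leq_add //; last by apply/subset_leq_card/subsetP=> x; rewrite !inE andbC.
apply: leq_trans Bm; apply: leq_trans AB.
by apply/subset_leq_card/subsetP=> x; rewrite !inE.
Qed.

(* The last hypothesis says (a - u) * (c - v) <= u * v. *)
Lemma leq_mul_sub (P Q u v x y a c : nat) :
    P + u <= a + x -> Q + v <= c + y -> a * c <= v * a + u * c ->
  P * Q <= u * v + Q * x + P * y.
Proof.
move=> Pa Qc ac.
have [Px|xP] := leqP P x; first by nia.
have [Qy|yQ] := leqP Q y; first by nia.
have [a' def_a] : exists a', a = u + a' by exists (a - u); lia.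
have [c' def_c] : exists c', c = v + c' by exists (c - v); lia.
have ac' : a' * c' <= u * v by nia.
have : (P - x) * (Q - y) <= a' * c' by apply: leq_mul; lia.
nia.
Qed.

Lemma neqbE (x y : bool) : (x != y) = (x == ~~ y).
Proof. by case: x y => [] []. Qed.

Section DiamondCount.
Variables (V : finType) (lt : rel V) (bot top : V) (k : V -> V -> bool).
Variable cap : bool -> nat.
Hypothesis lt_trans : transitive lt.
Hypothesis deg : forall i u w,
  #|[set m | [&& lt u m, lt m w, k u m == i & k m w == i]]| <= cap i.
Variables A B C : {set V}.
Hypothesis bot_lt : forall v, v \in A :|: B :|: C -> lt bot v.
Hypothesis lt_top : forall v, v \in A :|: B :|: C -> lt v top.
Variables P Q : nat.
Hypothesis cardA : forall b, b \in B ->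
  #|[set a in A | lt a b]| = P + (cap true + cap false).
Hypothesis cardC : forall b, b \in B ->
  #|[set c in C | lt b c]| = Q + (cap true + cap false).

Let low b := [set a in A | [&& lt a b, k bot a == k bot b & k a b == ~~ k bot b]].
Let high b := [set c in C | [&& lt b c, k c top == k b top & k b c == ~~ k b top]].

(* Let i be the colour of (bot, b).  The sets a < b with (bot, a) of colour ~~ i
   and the sets c > b with (c, top) of colour i form a complete bipartite
   comparability graph, in which each a has few c of colour i and each c has few
   a of the other colour: so there cannot be many of both. *)
Lemma below_above_count b : b \in B -> k b top = ~~ k bot b ->
  P * Q <= cap true * cap false + Q * #|low b| + P * #|high b|.
Proof.
move=> bB; set i := k bot b => bT.
have bBI : b \in A :|: B :|: C by rewrite !inE bB orbT.
have aI v : v \in A -> v \in A :|: B :|: C by rewrite !inE => ->.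
have cI v : v \in C -> v \in A :|: B :|: C by rewrite !inE => ->; rewrite orbT.
pose Ab := [set a in A | lt a b]; pose Cb := [set c in C | lt b c].
pose AZ := [set a in Ab | k bot a == ~~ i]; pose CZ := [set c in Cb | k c top == i].
have capi : cap true + cap false = cap i + cap (~~ i).
  by case: (i) => //; rewrite addnC.
have capM : cap true * cap false = cap (~~ i) * cap i.
  by case: (i) => //; rewrite mulnC.
rewrite capM; apply: (@leq_mul_sub _ _ _ _ _ _ #|AZ| #|CZ|).
- have : #|[set a in Ab | k bot a == i]| <= cap i + #|low b|.
    apply: leq_trans (leq_card_split (p := fun a => k a b == i) _ (deg i bot b)) _.
      apply/subsetP=> a; rewrite !inE => /andP[/andP[/andP[aA ->] ->] ->].
      by rewrite bot_lt ?aI.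
    rewrite leq_add2l; apply/subset_leq_card/subsetP=> a; rewrite !inE.
    by case/andP=> /andP[/andP[-> ->] ->]; rewrite neqbE.
  have := cardA bB; rewrite -/Ab -(cardsID [set a | k bot a == ~~ i] Ab).
  have -> : Ab :&: [set a | k bot a == ~~ i] = AZ by apply/setP=> a; rewrite !inE.
  have -> : Ab :\: [set a | k bot a == ~~ i] = [set a in Ab | k bot a == i].
    by apply/setP=> a; rewrite !inE andbC neqbE negbK.
  lia.
- have : #|[set c in Cb | k c top == ~~ i]| <= cap (~~ i) + #|high b|.
    apply: leq_trans (leq_card_split (p := fun c => k b c == ~~ i) _ (deg (~~ i) b top)) _.
      apply/subsetP=> c; rewrite !inE => /andP[/andP[/andP[cC ->] ->] ->].
      by rewrite lt_top ?cI.
    rewrite leq_add2l; apply/subset_leq_card/subsetP=> c; rewrite !inE bT.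
    by case/andP=> /andP[/andP[-> ->] ->]; rewrite neqbE.
  have := cardC bB; rewrite -/Cb -(cardsID [set c | k c top == i] Cb).
  have -> : Cb :&: [set c | k c top == i] = CZ by apply/setP=> c; rewrite !inE.
  have -> : Cb :\: [set c | k c top == i] = [set c in Cb | k c top == ~~ i].
    by apply/setP=> c; rewrite !inE andbC neqbE.
  lia.
(* Double counting over [AZ] and [CZ]: the [c] joined to [a] in colour [i] are middles between [a]
   and [top], and the [a] joined to [c] in colour [~~ i] are middles between [bot] and [c]. *)
rewrite -sum_nat_const.
apply: leq_trans (_ : \sum_(a in AZ) (cap i + #|[set c in CZ | k a c == ~~ i]|) <= _).
  apply: leq_sum => a; rewrite !inE => /andP[/andP[aA ab] _].
  apply: leq_trans (leq_card_split (p := fun c => k a c == i) _ (deg i a top)) _.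
    apply/subsetP=> c; rewrite !inE => /andP[/andP[/andP[cC bc] ->] ->].
    by rewrite (lt_trans ab bc) lt_top ?cI.
  rewrite leq_add2l; apply/subset_leq_card/subsetP=> c; rewrite !inE.
  by case/andP=> -> /=; rewrite neqbE.
rewrite big_split sum_nat_const mulnC leq_add2l sum_card_exchange.
apply: leq_sum_card => c; rewrite !inE => /andP[/andP[cC bc] _].
apply: leq_trans (deg (~~ i) bot c); apply/subset_leq_card/subsetP=> a.
rewrite !inE => /andP[/andP[/andP[aA ab] ->] ->].
by rewrite (lt_trans ab bc) bot_lt ?aI.
Qed.

(** Sum [below_above_count] over the sets of [B] with two different colours. For fixed [a], every
    [b] with [a] in [low b] is a middle between [a] and [top] in colour [~~ k bot a], so there are
    few; [high] is symmetric. *)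
Lemma diamond_free_count :
  (#|B| - (cap true + cap false)) * (P * Q - cap true * cap false)
    <= maxn (cap true) (cap false) * (Q * #|A| + P * #|C|).
Proof.
set M := maxn _ _.
have capM i : cap i <= M by case: i; rewrite ?leq_maxl ?leq_maxr.
have botB b : b \in B -> lt bot b by move=> bB; rewrite bot_lt // !inE bB orbT.
have topB b : b \in B -> lt b top by move=> bB; rewrite lt_top // !inE bB orbT.
pose B' := [set b in B | k b top == ~~ k bot b].
have cardB' : #|B| - (cap true + cap false) <= #|B'|.
  rewrite leq_subLR addnC -(cardsID [set b | k b top == ~~ k bot b] B).
  rewrite leq_add //.
    by apply/subset_leq_card/subsetP=> b; rewrite !inE.
  (* A set of [B] with two equal colours is a middle between [bot] and [top]. *)
  have sub : B :\: [set b | k b top == ~~ k bot b] \subset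
      \bigcup_(i : bool) [set m | [&& lt bot m, lt m top, k bot m == i & k m top == i]].
    apply/subsetP=> b; rewrite !inE => /andP[bk bB].
    apply/bigcupP; exists (k bot b) => //; rewrite !inE botB ?topB // eqxx /=.
    by move: bk; rewrite neqbE negbK => /eqP ->.
  apply: leq_trans (subset_leq_card sub) _.
  rewrite (bigD1 true) //= (bigD1 false) //= big_pred0 ?setU0; last by case.
  by apply: leq_trans (leq_card_setU _ _) _; rewrite leq_add.
have lowS : \sum_(b in B') #|low b| <= M * #|A|.
  rewrite sum_card_exchange; apply: leq_sum_card => a aA.
  apply: leq_trans (capM (~~ k bot a)); apply: leq_trans (deg _ a top).
  apply/subset_leq_card/subsetP=> b; rewrite !inE.
  case/andP=> /andP[bB /eqP bT] /and3P[-> /eqP -> /eqP ->].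
  by rewrite topB // bT !eqxx.
have highS : \sum_(b in B') #|high b| <= M * #|C|.
  rewrite sum_card_exchange; apply: leq_sum_card => c cC.
  apply: leq_trans (capM (~~ k c top)); apply: leq_trans (deg _ bot c).
  apply/subset_leq_card/subsetP=> b; rewrite !inE.
  case/andP=> /andP[bB /eqP bT] /and3P[-> /eqP -> /eqP ->].
  by rewrite botB // bT negbK !eqxx.
have : #|B'| * (P * Q) <= \sum_(b in B')
    (cap true * cap false + Q * #|low b| + P * #|high b|).
  rewrite -sum_nat_const; apply: leq_sum => b; rewrite inE => /andP[bB /eqP].
  exact: below_above_count.
rewrite !big_split /= sum_nat_const -!big_distrr /= => le_sum.
apply: leq_trans (leq_mul cardB' (leqnn _)) _; rewrite mulnBr leq_subLR.
apply: leq_trans le_sum _; rewrite -addnA leq_add2l mulnDr leq_add //.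
  by rewrite mulnCA leq_mul.
by rewrite mulnCA leq_mul.
Qed.

End DiamondCount.

(** * Boolean lattices without a copy of either diamond *)

(** The number of nonempty subsets of size at most [p] of an [m]-set; the empty set is left out
    because it serves as [bot]. *)
Definition small_bin m p := \sum_(1 <= l < p.+1) 'C(m, l).

Lemma small_binS m p : small_bin m p.+1 = small_bin m p + 'C(m, p.+1).
Proof. by rewrite /small_bin big_nat_recr. Qed.

Lemma small_bin0 m : small_bin m 0 = 0.
Proof. by rewrite /small_bin big_geq. Qed.

Lemma card_small_subsets (T : finType) (b : {set T}) p :
  #|[set a : {set T} | (a \subset b) && (0 < #|a| <= p)]| = small_bin #|b| p.
Proof.
elim: p => [|p IHp].
  rewrite small_bin0 (_ : [set a | _] = set0) ?cards0 //.
  by apply/setP=> a; rewrite !inE; case: (#|a|) => [|?]; rewrite andbF.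
rewrite small_binS -IHp -cards_draws.
rewrite -[LHS](cardsID [set a : {set T} | #|a| <= p]); congr (_ + _).
  by apply: eq_card => a; rewrite !inE; case: (a \subset b) => //=; lia.
by apply: eq_card => a; rewrite !inE; case: (a \subset b) => //=; lia.
Qed.

Definition cap_of (s r : nat) (i : bool) := if i then r else s.
Definition color_of (i : bool) : 'I_2 := if i then ord_max else ord0.

Lemma eq_color_of (x : 'I_2) i : ((x == ord_max) == i) = (x == color_of i).
Proof. by case: i; case: x => -[|[|//]] Hx. Qed.

(** Contrapositive of [diamond_free_count]: [A] holds the nonempty sets of size at most [p], [B] is
    level [g], [C] holds the complements of nonempty sets of size at most [p'], and the absence of
    diamonds gives the caps [s.-1] and [r.-1]. *)
Lemma diamond_ramsey n g p p' s r P Q :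
    0 < s -> 0 < r -> p < g -> p' < n - g ->
    small_bin g p = P + (r.-1 + s.-1) ->
    small_bin (n - g) p' = Q + (r.-1 + s.-1) ->
    maxn r.-1 s.-1 * (Q * small_bin n p + P * small_bin n p') <
      ('C(n, g) - (r.-1 + s.-1)) * (P * Q - r.-1 * s.-1) ->
  boolean_ramsey (diamond s) (diamond r) n.
Proof.
move=> s0 r0 pg p'g defP defQ; rewrite ltnNge => /negP big_count c.
pose mids i (u w : {set 'I_n}) := [set m : {set 'I_n} |
  [&& u \proper m, m \proper w, (c u m == ord_max) == i & (c m w == ord_max) == i]].
have [/existsP[i /existsP[u /existsP[w le_i]]]|no_copy] :=
    boolP [exists i, [exists u, [exists w, cap_of s r i <= #|mids i u w|]]].
  have copy_i : has_copy c (color_of i) (diamond (cap_of s r i)).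
    apply: (@has_copy_diamond _ _ _ _ _ u w); first by case: (i).
    apply: leq_trans le_i _; apply/subset_leq_card/subsetP=> m.
    by rewrite !inE !eq_color_of.
  by case: i {le_i} copy_i; [right | left].
case: big_count.
pose A := [set a : {set 'I_n} | 0 < #|a| <= p].
pose B := [set b : {set 'I_n} | #|b| == g].
pose C := [set d : {set 'I_n} | 0 < #|~: d| <= p'].
have cardB : #|B| = 'C(n, g) by rewrite card_draws card_ord.
have cardA : #|A| = small_bin n p.
  rewrite -[in RHS](card_ord n) -cardsT -card_small_subsets.
  by apply: eq_card => a; rewrite !inE subsetT.
have cardC : #|C| = small_bin n p'.
  rewrite -[in RHS](card_ord n) -cardsT -card_small_subsets.
  rewrite -(card_imset _ (@setC_inj _)); apply: eq_card => d; rewrite !inE subsetT.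
  apply/imsetP/idP=> [[e + ->]|]; first by rewrite inE.
  by exists (~: d); rewrite ?inE setCK.
rewrite -cardB -cardA -cardC.
have cardsE (x : {set 'I_n}) : #|x| + #|~: x| = n by rewrite cardsC card_ord.
have gn : g <= n by lia.
have pn : p < n by lia.
have p'n : p' < n by lia.
apply: (@diamond_free_count {set 'I_n} (fun x y => x \proper y) set0 setT
  (fun u w => c u w == ord_max) (cap_of s.-1 r.-1)).
- by move=> y x z; apply: proper_trans.
- move=> i u w; rewrite leqNgt; apply: contraNN no_copy => lt_i.
  apply/existsP; exists i; apply/existsP; exists u; apply/existsP; exists w.
  by apply: leq_trans lt_i; case: (i) => /=; rewrite prednK.
- move=> v; rewrite !inE => v_in /=.
  by rewrite properEcard sub0set cards0; have := cardsE v; lia.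
- move=> v; rewrite !inE => v_in /=.
  by rewrite properEcard subsetT cardsT card_ord; have := cardsE v; lia.
- move=> b; rewrite inE => /eqP bg; rewrite /= -defP -bg -card_small_subsets.
  apply: eq_card => a; rewrite !inE properEcard bg andbC.
  by case: (a \subset b) => //=; lia.
- move=> b; rewrite inE => /eqP bg; rewrite /= -defQ.
  have cb : #|~: b| = n - g by have := cardsE b; lia.
  have proper_setC (e : {set 'I_n}) :
      e \subset ~: b -> 0 < #|e| <= p' -> b \proper ~: e.
    move=> eb e_small; rewrite properCr properEcard eb cb.
    by case/andP: e_small => _ /leq_ltn_trans ->.
  rewrite -cb -card_small_subsets -[LHS](card_imset _ (@setC_inj _)).
  apply: eq_card => d.
  rewrite [RHS]inE; apply/imsetP/idP=> [[e]|].
    rewrite !inE properEcard => /and3P[e1 e2 _] ->.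
    by rewrite setCS e2.
  move=> /andP[db d_small]; exists (~: d); rewrite ?setCK // !inE setCK d_small.
  exact: proper_setC.
Qed.

(* For k <= 7 the inequality of diamond_ramsey is too tight for estimates (at
   k = 4 the two sides differ by about 1%), so it is evaluated for all s and r,
   in binary arithmetic.  Here R = r.-1 and S = s.-1. *)
Section SmallCases.
Local Open Scope Z_scope.
(** The first four tests ensure that the truncated subtractions of [diamond_ramsey] agree with those
    in [Z]. *)
Definition small_test (A C Ha Hc B R S : Z) : bool :=
  let P := A - R - S in let Q := C - R - S in
  [&& 0 <=? P, 0 <=? Q, R * S <=? P * Q, R + S <=? B &
    Z.max R S * (Q * Ha + P * Hc) <? (B - R - S) * (P * Q - R * S)].

Lemma Zof_nat_sub2 (a b c p : nat) : a = (p + (b + c))%N ->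
  Z.of_nat a - Z.of_nat b - Z.of_nat c = Z.of_nat p.
Proof. by lia. Qed.

Lemma Zof_nat_mulB (a b c d w : nat) : (a * b = w + c * d)%N ->
  Z.of_nat a * Z.of_nat b - Z.of_nat c * Z.of_nat d = Z.of_nat w.
Proof. by lia. Qed.

End SmallCases.

Definition small_test_upto K A C Ha Hc B : bool :=
  all (fun R => all (fun S => (R + S <= K) ==>
    small_test A C Ha Hc B (Z.of_nat R) (Z.of_nat S)) (iota 1 K)) (iota 1 K).

Lemma small_testP n g p p' s r K :
    1 < s -> 1 < r -> s + r <= K.+2 -> p < g -> p' < n - g ->
    small_test_upto K (Z.of_nat (small_bin g p)) (Z.of_nat (small_bin (n - g) p'))
      (Z.of_nat (small_bin n p)) (Z.of_nat (small_bin n p')) (Z.of_nat 'C(n, g)) ->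
  boolean_ramsey (diamond s) (diamond r) n.
Proof.
move=> s1 r1 srK pg p'g /allP test.
have rI : r.-1 \in iota 1 K by rewrite mem_iota; lia.
have sI : s.-1 \in iota 1 K by rewrite mem_iota; lia.
have := allP (test _ rI) _ sI; rewrite (_ : r.-1 + s.-1 <= K) /=; last by lia.
rewrite /small_test => /and5P[/Z.leb_le P0 /Z.leb_le Q0 /Z.leb_le RS /Z.leb_le Bs /Z.ltb_lt].
move: P0 Q0 RS Bs; set A := small_bin g p; set C' := small_bin (n - g) p'.
set Ha := small_bin n p; set Hc := small_bin n p'; set R := r.-1; set S := s.-1.
move=> P0 Q0 RS Bs lt_count.
have [P defP] : exists P, A = P + (R + S) by exists (A - (R + S)); lia.
have [Q defQ] : exists Q, C' = Q + (R + S) by exists (C' - (R + S)); lia.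
have [B' defB] : exists B', 'C(n, g) = B' + (R + S).
  by exists ('C(n, g) - (R + S)); lia.
have [W defW] : exists W, P * Q = W + R * S by exists (P * Q - R * S); nia.
apply: (@diamond_ramsey n g p p' s r P Q) => //; [lia | lia |].
rewrite -/R -/S -/Ha -/Hc defB defW !addnK.
move: lt_count; rewrite (Zof_nat_sub2 defP) (Zof_nat_sub2 defQ) (Zof_nat_sub2 defB).
rewrite (Zof_nat_mulB defW).
have -> : Z.max (Z.of_nat R) (Z.of_nat S) = Z.of_nat (maxn R S) by lia.
lia.
Qed.

(** Unlocks the big operator so that [vm_compute] can evaluate it. *)
Lemma small_binE m p : small_bin m p = foldr (fun l => addn 'C(m, l)) 0 (iota 1 p).
Proof. by rewrite /small_bin unlock /reducebig /index_iota subn1. Qed.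

Lemma diamond_ramsey_small k s r :
  3 <= k <= 7 -> 1 < s -> 1 < r -> s + r <= 2 ^ k.-1 ->
  boolean_ramsey (diamond s) (diamond r) k.*2.+1.
Proof.
move=> /andP[k3 k7] s1 r1 sr.
have upto : s + r <= (2 ^ k.-1 - 2).+2 by have := ltn_expl k.-1 (isT : 1 < 2); lia.
have [k_eq|[k_eq|[k_eq|[k_eq|k_eq]]]] :
  k = 3 \/ k = 4 \/ k = 5 \/ k = 6 \/ k = 7 by lia.
all: subst k.
(* The numbers are the dimension [2k + 1], the level [k], and the size bounds [p] and [p']. *)
- by apply: (@small_testP 7 3 2 2 _ _ _ s1 r1 upto isT isT); rewrite !small_binE; vm_compute.
- by apply: (@small_testP 9 4 3 3 _ _ _ s1 r1 upto isT isT); rewrite !small_binE; vm_compute.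
- by apply: (@small_testP 11 5 3 3 _ _ _ s1 r1 upto isT isT); rewrite !small_binE; vm_compute.
- by apply: (@small_testP 13 6 3 4 _ _ _ s1 r1 upto isT isT); rewrite !small_binE; vm_compute.
- by apply: (@small_testP 15 7 4 4 _ _ _ s1 r1 upto isT isT); rewrite !small_binE; vm_compute.
Qed.

(** * Estimates of binomial coefficients and their sums *)

Lemma small_bin_full m : (small_bin m m).+1 = 2 ^ m.
Proof.
have -> : 2 ^ m = \sum_(0 <= i < m.+1) 'C(m, i).
  rewrite big_mkord -[2]/(1 + 1) expnDn.
  by apply: eq_bigr => i _; rewrite !exp1n !muln1.
by rewrite big_ltn // bin0 add1n.
Qed.

(** Up to index [(m + 1) / 3] the coefficients at least double at each step, so the sum behaves like
    a geometric series. *)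
Lemma small_bin_le m p : 3 * p <= m.+1 -> small_bin m p <= 2 * 'C(m, p).
Proof.
elim: p => [|p IHp] pm; first by rewrite small_bin0.
by rewrite small_binS; have := mul_bin_left m p; have := IHp; nia.
Qed.

(** From index [p] on the coefficients at least halve, so the terms beyond [p] add up to at most
    ['C(m, p)], which is itself at most a third of [small_bin m p] because the terms [p - 2] and
    [p - 1] are no smaller. *)
Lemma small_bin_ge m p : 2 < p <= m -> m + 3 <= 2 * p -> 2 * m <= (3 * p).+1 ->
  3 * 2 ^ m <= 4 * small_bin m p.
Proof.
move=> /andP[p2 pm] mp1 mp2.
have tail q : p <= q -> small_bin m q + 'C(m, q) <= small_bin m p + 'C(m, p).
  move=> /subnK <-; elim: (q - p) => [//|d IHd]; rewrite addSn small_binS.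
  apply: leq_trans IHd; rewrite -addnA leq_add2l.
  by have := mul_bin_left m (d + p); nia.
have := tail m pm; rewrite binn addn1 small_bin_full => full.
suff : 3 * 'C(m, p) <= small_bin m p by lia.
case: p p2 pm mp1 mp2 {tail full} => [|[|[|p]]] // p2 pm mp1 mp2.
have le1 : 'C(m, p.+3) <= 'C(m, p.+2) by have := mul_bin_left m p.+2; nia.
have le2 : 'C(m, p.+2) <= 'C(m, p.+1) by have := mul_bin_left m p.+1; nia.
by rewrite !small_binS; lia.
Qed.

Lemma leq_bin_center m l : l <= m -> 'C(m.*2, l) <= 'C(m.*2, m).
Proof.
move=> /subnK; move: (m - l) => d; elim: d l => [l <- //|d IHd l dl].
apply: leq_trans (IHd l.+1 _); last by rewrite -dl addnS.
by have := mul_bin_left m.*2 l; nia.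
Qed.

(** Each step multiplies the central coefficient by [2(2m + 1)/(m + 1) >= 2]; the bound fails at
    [m = 4] and starts with 160 <= 252. *)
Lemma exp2_leq_bin_center m : 4 < m -> 5 * 2 ^ m <= 'C(m.*2, m).
Proof.
elim: m => // m IHm; rewrite ltnS leq_eqVlt => /orP[/eqP <- //|m4].
have e3 : m.+1 * 'C(m.+1.*2, m.+1) = m.+1.*2 * 'C(m.*2.+1, m).
  by rewrite doubleS mul_bin_diag.
have e4 : m.+1 * 'C(m.*2.+1, m) = m.*2.+1 * 'C(m.*2, m).
  by rewrite [LHS](_ : _ = (m.*2.+1 - m) * 'C(m.*2.+1, m)) ?mul_bin_down //; lia.
by rewrite expnS; have := IHm m4; nia.
Qed.

Lemma mul_chain a b c x y z u0 u1 u2 u3 :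
    a * u1 = x * u0 -> b * u2 = y * u1 -> c * u3 = z * u2 ->
  a * b * c * u3 = x * y * z * u0.
Proof.
move=> e1 e2 e3; rewrite -mulnA e3.
have -> : a * b * (z * u2) = a * z * (b * u2) by lia.
rewrite e2; have -> : a * z * (y * u1) = y * z * (a * u1) by lia.
by rewrite e1; lia.
Qed.

(* The ratio of the two coefficients is at least 143/60 > 23/10, attained at g = 10. *)
Lemma bin_tail_gap g p : 8 < g -> 3 * p <= g.*2.+1 -> g.*2 < 3 * p + 2 ->
  23 * 'C(g.*2, p) <= 10 * 'C(g.*2, g).
Proof.
move=> g8 pg gp.
suff : 23 * 'C(g.*2, p) <= 10 * 'C(g.*2, p.+3).
  by move/leq_trans; apply; rewrite leq_mul2l leq_bin_center ?orbT //; lia.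
have chain := mul_chain (mul_bin_left g.*2 p) (mul_bin_left g.*2 p.+1) (mul_bin_left g.*2 p.+2).
have le_prod : 23 * (p.+1 * p.+2 * p.+3) <=
    10 * ((g.*2 - p) * (g.*2 - p.+1) * (g.*2 - p.+2)).
  have [q def_q] : exists q, g.*2 - p.+2 = q by eexists.
  have -> : g.*2 - p.+1 = q.+1 by lia.
  have -> : g.*2 - p = q.+2 by lia.
  (* The cubic bound [le_q] fails at [q = 10], which occurs only for [g = 9]. For larger [q],
     [3 * p <= g.*2.+1] reads [2 * p <= q + 3], which gives [le_p]. *)
  rewrite def_q; have [q10|q11] := leqP q 10.
    have -> : p = 6 by lia.
    have -> : q = 10 by lia.
    by [].
  have le_p : 8 * (p.+1 * p.+2 * p.+3) <= (q + 5) * (q + 7) * (q + 9).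
    rewrite (_ : 8 * _ = (p.+1 * 2) * (p.+2 * 2) * (p.+3 * 2)); last by lia.
    by rewrite !leq_mul //; lia.
  have le_q : 23 * ((q + 5) * (q + 7) * (q + 9)) <= 80 * (q.+2 * q.+1 * q).
    have [v ->] : exists v, q = v + 11 by exists (q - 11); lia.
    by clear; nia.
  lia.
rewrite -(leq_pmul2l (_ : 0 < p.+1 * p.+2 * p.+3)) //.
rewrite mulnCA [leqRHS]mulnCA chain mulnA [leqRHS]mulnA leq_mul2r.
by rewrite le_prod orbT.
Qed.

(** Used with [g = k + 1]. With [B] the central coefficient, the left side of the counting
    inequality is at most [20/23 * P^2 * B] and the right side at least [19/20 * 15/16 * P^2 * B],
    which is larger. *)
Lemma diamond_ramsey_large g s r :
  8 < g -> 1 < s -> 1 < r -> s + r <= 2 ^ (g - 2) ->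
  boolean_ramsey (diamond s) (diamond r) g.*2.
Proof.
move=> g8 s1 r1 sr.
(* The largest bound that [small_bin_le] allows in dimension [2g]; it is also large enough for
   [small_bin_ge] in dimension [g]. *)
pose p := g.*2.+1 %/ 3.
have pg : 3 * p <= g.*2.+1 by rewrite /p; lia.
have gp : g.*2 < 3 * p + 2 by rewrite /p; lia.
move: p pg gp => p pg gp.
have p_lt : p < g by lia.
have p_lt' : p < g.*2 - g by lia.
set X := 2 ^ (g - 2) in sr.
have expX : 2 ^ g = 4 * X by rewrite /X -(subnK (_ : 2 <= g)) ?expnD 1?mulnC ?addnK //; lia.
have geX : 3 * X <= small_bin g p.
  have := @small_bin_ge g p; rewrite expX => ge_p.
  suff : 3 * (4 * X) <= 4 * small_bin g p by lia.
  by apply: ge_p; lia.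
have leH : 23 * small_bin g.*2 p <= 20 * 'C(g.*2, g).
  have := bin_tail_gap g8 pg gp; have := small_bin_le (m := g.*2) pg; lia.
have leB : 20 * X <= 'C(g.*2, g).
  by have := @exp2_leq_bin_center g; rewrite expX => /(_ (ltac:(lia))); lia.
have [P defP] : exists P, small_bin g p = P + (r.-1 + s.-1).
  by exists (small_bin g p - (r.-1 + s.-1)); lia.
have subg : g.*2 - g = g by lia.
apply: (@diamond_ramsey g.*2 g p p s r P P) => //; rewrite ?subg //; try lia.
move: leH leB geX defP; set H := small_bin g.*2 p; set B := 'C(_, _).
move=> leH leB geX defP.
have leP : 2 * (r.-1 + s.-1) <= P by lia.
have P0 : 0 < P by lia.
have leBS : 20 * (r.-1 + s.-1) < B by lia.
move: (r.-1) (s.-1) defP leP leBS => R S defP leP leBS.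
have RS : 16 * (R * S) <= P * P.
  have := leq_mul leP leP; have := (nat_AGM2 R S).1; rewrite expnS expn1; lia.
have PW : 15 * (P * P) <= 16 * (P * P - R * S) by lia.
have BB : 19 * B <= 20 * (B - (R + S)) by lia.
have M_le : 2 * maxn R S <= P by lia.
have B0 : 0 < B by lia.
have lhs : 23 * (maxn R S * (P * H + P * H)) <= 20 * (P * P * B).
  apply: leq_trans (_ : 23 * (P * P * H) <= _); first by nia.
  by rewrite mulnCA [20 * _]mulnCA leq_mul2l leH orbT.
have rhs : 285 * (P * P * B) <= 320 * ((B - (R + S)) * (P * P - R * S)).
  have := leq_mul PW BB; lia.
have PPB : 0 < P * P * B by rewrite !muln_gt0 P0 B0.
lia.
Qed.

(** * A diamond against a cup *)

Lemma card_sets n : #|{: {set 'I_n}}| = 2 ^ n.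
Proof. by rewrite -cardsT -powersetT card_powerset cardsT card_ord. Qed.

(** Expand [(2 + 1)^n] by the set of factors that contribute 2. *)
Lemma sum_exp2_card n : \sum_(c : {set 'I_n}) 2 ^ #|c| = 3 ^ n.
Proof.
rewrite -[3]/(2 + 1) -[in RHS](card_ord n) -prod_nat_const bigA_distr.
apply: eq_bigr => c _; rewrite -prod_nat_const [in RHS]big_mkcond /=.
by rewrite big_mkcond.
Qed.

Lemma diamond_cup_ramsey n s t : 0 < s -> 0 < t ->
  2 ^ n * (t.*2 + s).-1 < 3 ^ n -> boolean_ramsey (diamond s) (cup t) n.
Proof.
move=> s0 t0 lt_3n c.
pose red (x y : {set 'I_n}) := c x y == ord_max.
have blueE x y : ~~ red x y = (c x y == ord0).
  by rewrite /red; case: (c x y) => -[|[|//]] ?.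
have [/existsP[x le_t]|no_cup] :=
    boolP [exists x : {set 'I_n}, t <= #|[set y : {set 'I_n} | (x \proper y) && red x y]|].
  by right; apply: has_copy_cup le_t.
have [/existsP[z le_s]|no_dia] := boolP [exists z : {set 'I_n}, s <= #|[set y : {set 'I_n} |
    [&& set0 \proper y, y \proper z, ~~ red set0 y & ~~ red y z]]|].
  left; apply: (@has_copy_diamond _ _ _ _ s0 set0 z).
  apply: leq_trans le_s _; apply/subset_leq_card/subsetP=> y.
  by rewrite !inE !blueE.
have cup_lt (x : {set 'I_n}) : #|[set y : {set 'I_n} | (x \proper y) && red x y]| <= t.-1.
  rewrite -ltnS prednK // ltnNge; apply: contraNN no_cup => le_t.
  by apply/existsP; exists x.
have dia_lt (z : {set 'I_n}) : #|[set y : {set 'I_n} |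
    [&& set0 \proper y, y \proper z, ~~ red set0 y & ~~ red y z]]| <= s.-1.
  rewrite -ltnS prednK // ltnNge; apply: contraNN no_dia => le_s.
  by apply/existsP; exists z.
pose down (z : {set 'I_n}) := [set y : {set 'I_n} | (y \proper z) && red y z].
have powerset_le (z : {set 'I_n}) : 2 ^ #|z| <= (t + s) + #|down z|.
  pose redup := [set y : {set 'I_n} | (set0 \proper y) && red set0 y].
  pose mids := [set y : {set 'I_n} |
    [&& set0 \proper y, y \proper z, ~~ red set0 y & ~~ red y z]].
  (* Besides [z], [set0] and the red pairs, a subset [y] of [z] has a red pair with [set0] or is the
     middle of a blue diamond; in all [2 + (t - 1) + (s - 1)] exceptions. *)
  have sub : powerset z \subset [set z; set0] :|: (down z :|: (redup :|: mids)).
    apply/subsetP=> y; rewrite !inE => yz; rewrite properEneq yz andbT.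
    rewrite proper0; case: eqP => //= _; case: eqP => //= _.
    by case: (red y z); case: (red set0 y).
  rewrite -card_powerset; apply: leq_trans (subset_leq_card sub) _.
  apply: (@leq_trans (2 + (#|down z| + (t.-1 + s.-1)))); last by lia.
  apply: leq_trans (leq_card_setU _ _) (leq_add _ _).
    by rewrite cards2; case: (_ != _).
  apply: leq_trans (leq_card_setU _ _) (leq_add (leqnn _) _).
  exact: leq_trans (leq_card_setU _ _) (leq_add (cup_lt _) (dia_lt _)).
have sum_down : \sum_(z in setT) #|down z| <= t.-1 * 2 ^ n.
  rewrite /down (eq_bigr (fun z : {set 'I_n} => #|[set y in [set: {set 'I_n}] |
    (y \proper z) && red y z]|)); last first.
    by move=> z _; apply: eq_card => y; rewrite !inE.
  rewrite sum_card_exchange.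
  have -> : 2 ^ n = #|[set: {set 'I_n}]| by rewrite cardsT card_sets.
  apply: leq_sum_card => y _; apply: leq_trans (cup_lt y).
  by apply/subset_leq_card/subsetP=> z; rewrite !inE.
suff : 3 ^ n <= 2 ^ n * (t.*2 + s).-1 by rewrite leqNgt lt_3n.
rewrite -sum_exp2_card.
have : \sum_(z : {set 'I_n}) 2 ^ #|z| <= \sum_(z : {set 'I_n}) ((t + s) + #|down z|).
  exact: leq_sum.
rewrite big_split sum_nat_const card_sets /=.
move: sum_down; under eq_bigl do rewrite inE.
set X := \sum_(z : {set 'I_n}) _; set Y := \sum_(z : {set 'I_n}) _ => XY Yle.
apply: leq_trans Yle _; apply: leq_trans (leq_add (leqnn _) XY) _.
by rewrite [_ * 2 ^ n]mulnC -mulnDr leq_mul2l; apply/orP; right; lia.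
Qed.

(** * Lower bounds from level colourings *)

Lemma copy_proper n k (c : boolean_lattice n -> boolean_lattice n -> 'I_k) i
    (H : pograph) (f : vertex H -> boolean_lattice n) u v :
  is_copy c i f -> (u < v)%O -> (f u : {set 'I_n}) \proper f v.
Proof.
move=> [f_inj f_homo _] uv.
have := f_homo _ _ (ltW uv); rewrite leEsubset properEneq => ->.
by rewrite andbT; apply: contraTneq uv => /f_inj ->; rewrite ltxx.
Qed.

(* The extra blue pair of set0 and [set ord0] creates no blue diamond and spares
   set0 one red pair; the bound is needed in this sharp form for t = 3. *)
Lemma not_ramsey_levels n l s t : 1 < s -> 0 < l ->
    small_bin n.+1 l <= t -> 2 ^ (n - l) <= t ->
  ~ boolean_ramsey (diamond s) (cup t) n.+1.
Proof.
move=> s1 l0 low_t high_t.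
pose blue (A B : {set 'I_n.+1}) :=
  (#|A| <= l < #|B|) || (A == set0) && (B == [set ord0]).
pose c (A B : boolean_lattice n.+1) : 'I_2 := if blue A B then ord0 else ord_max.
have blueP A B : c A B = ord0 -> blue A B by rewrite /c; case: (blue A B).
have redP A B : c A B = ord_max -> ~~ blue A B by rewrite /c; case: (blue A B).
case/(_ c) => -[f copy_f]; have [f_inj _ f_col] := copy_f.
  (* A middle cannot lie both above level [l] for its lower pair and at most at [l] for its upper
     one, so its lower pair is the extra one. All middles then coincide, against [1 < s]. *)
  have mid_eq (j : 'I_s) : f (DiaMid j) = [set ord0].
    have low_lt : (DiaBot < DiaMid j :> vertex (diamond s))%O by apply: edge_lt.
    have := copy_proper copy_f low_lt.
    have /blueP := f_col DiaBot (DiaMid j) isT.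
    have /blueP := f_col (DiaMid j) DiaTop isT.
    rewrite /blue => /orP[/andP[small_m _]|/andP[/eqP-> _]]; last first.
      by rewrite [_ \proper set0]properE sub0set andbF.
    by rewrite ltnNge small_m andbF => /andP[_ /eqP].
  have := f_inj _ _ (etrans (mid_eq (Ordinal (ltnW s1))) (esym (mid_eq (Ordinal s1)))).
  by case.
set x : {set 'I_n.+1} := f CupBot.
pose R := [set y : {set 'I_n.+1} | (x \proper y) && ~~ blue x y].
have tR : t <= #|R|.
  apply: (@inj_leq_card _ R t (fun j => f (CupMid j))) => [i j /f_inj [] //|j].
  have bot_lt : (CupBot < CupMid j :> vertex (cup t))%O by apply: edge_lt.
  rewrite inE (copy_proper copy_f bot_lt).
  exact: redP (f_col CupBot (CupMid j) isT).
have [x_small|x_big] := leqP #|x| l.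
  (* [w] is a low set outside [R]: [x] itself, or for [x = set0] the singleton of the extra blue
     pair. *)
  pose w := if x == set0 then [set ord0] else x.
  pose L := [set y : {set 'I_n.+1} | 0 < #|y| <= l].
  have wL : w \in L.
    by rewrite inE /w; case: eqP => [_|/eqP]; rewrite ?cards1 // -card_gt0 x_small andbT.
  have cardL : #|L| = small_bin n.+1 l.
    rewrite -[in RHS](card_ord n.+1) -cardsT -card_small_subsets.
    by apply: eq_card => y; rewrite !inE subsetT.
  have : R \subset L :\ w.
    apply/subsetP=> y; rewrite !inE /blue x_small /= negb_or -leqNgt.
    case/and3P=> xy -> xy0; rewrite andbT lt0n cards_eq0.
    have -> : y != set0 by rewrite -proper0; apply: sub_proper_trans xy; rewrite sub0set.
    rewrite andbT /w; move: xy0; case: eqP => //= _ _.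
    by apply: contraTneq xy => ->; rewrite properxx.
  move/subset_leq_card/(leq_trans tR); apply/negP; rewrite -ltnNge.
  by apply: leq_trans low_t; rewrite -cardL [leqRHS](cardsD1 w) wL.
have : R \subset [set ~: d | d in powerset (~: x) :\ ~: x].
  apply/subsetP=> y; rewrite !inE => /andP[xy _]; apply/imsetP.
  exists (~: y); rewrite ?setCK // !inE (inj_eq (@setC_inj _)) setCS proper_sub // andbT.
  by apply: contraTneq xy => ->; rewrite properxx.
move/subset_leq_card/(leq_trans tR); rewrite card_imset; last exact: setC_inj.
apply/negP; rewrite -ltnNge; apply: (@leq_trans #|powerset (~: x)|).
  by rewrite [leqRHS](cardsD1 (~: x)) inE subxx.
rewrite card_powerset; apply: leq_trans high_t; rewrite leq_exp2l //.
by have := cardsC x; rewrite card_ord; move: x_big; clear; lia.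
Qed.

Lemma not_ramsey0 s t : 0 < t -> ~ boolean_ramsey (diamond s) (cup t) 0.
Proof.
move=> t0 /(_ (fun _ _ => ord0)) [] [f copy_f].
  have lt_bt : (DiaBot < DiaTop :> vertex (diamond s))%O by [].
  have := copy_proper copy_f lt_bt; rewrite properEcard => /andP[_].
  by have := max_card (mem (f DiaTop : {set 'I_0})); rewrite card_ord leqn0 => /eqP ->.
have lt_bm : (CupBot < CupMid (Ordinal t0) :> vertex (cup t))%O by apply: edge_lt.
have := copy_proper copy_f lt_bm; rewrite properEcard => /andP[_].
by have := max_card (mem (f (CupMid (Ordinal t0)) : {set 'I_0})); rewrite card_ord leqn0 => /eqP ->.
Qed.

Lemma ex_BR2 G1 G2 n : boolean_ramsey G1 G2 n ->
  exists2 N, is_BR2 G1 G2 N & N <= n.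
Proof.
move=> Gn; have ex_n : exists n, `[< boolean_ramsey G1 G2 n >] by exists n; apply/asboolP.
case: (ex_minnP ex_n) => N /asboolP GN minN; exists N; last exact/minN/asboolP.
by split=> // M GM; apply/minN/asboolP.
Qed.

Lemma double_exp3_lt_exp4 k : 2 < k -> 2 * 3 ^ k < 2 ^ k * 2 ^ k.
Proof.
elim: k => // k IHk; rewrite ltnS leq_eqVlt => /orP[/eqP <- //|k2].
by rewrite !expnS; have := IHk k2; lia.
Qed.

(** Twice the number of nonempty sets of size at most 2 in a [(k + 1)]-set is on the left; the bound
    fails at [k = 7]. *)
Lemma triangle_leq_exp2 k : 7 < k -> k.+1 * k.+2 <= 2 * 2 ^ (k - 2).
Proof.
elim: k => // k IHk; rewrite ltnS leq_eqVlt => /orP[/eqP <- //|k7].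
by rewrite subSn ?expnS; have := IHk k7; nia.
Qed.

Lemma cup_ramsey_gt k s t M : 2 < k -> 1 < s -> 2 < t -> 2 ^ (k - 2) <= t ->
  boolean_ramsey (diamond s) (cup t) M -> k < M.
Proof.
move=> k2 s1 t2 kt ramM; rewrite ltnNge; apply/negP => Mk.
have t0 : 0 < t by lia.
case: M Mk ramM => [_|M Mk]; first exact: not_ramsey0.
(* At [k = 3] the power [2 ^ (k - 2)] is only 2, so [2 < t] is what helps. *)
have k_le_t : k <= t.
  have [k3|k3] := leqP k 3; first by lia.
  case: k k2 kt {Mk} k3 => [|[|[|[|k]]]] //= _ kt _; apply: leq_trans kt.
  by rewrite !subSS subn0 !expnS; have := ltn_expl k (isT : 1 < 2); lia.
apply: (@not_ramsey_levels M 1) => //.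
  by rewrite small_binS small_bin0 bin1; lia.
by apply: leq_trans kt; rewrite leq_exp2l //; lia.
Qed.

Lemma cup_ramsey_gt_succ k s t M : 7 < k -> 1 < s -> 2 ^ (k - 2) <= t ->
  boolean_ramsey (diamond s) (cup t) M -> k.+1 < M.
Proof.
move=> k7 s1 kt ramM; rewrite ltnNge; apply/negP => Mk.
have t0 : 0 < t by apply: leq_trans kt; rewrite expn_gt0.
case: M Mk ramM => [_|M Mk]; first exact: not_ramsey0.
have := triangle_leq_exp2 k7 => tri.
apply: (@not_ramsey_levels M 2) => //.
  rewrite !small_binS small_bin0 bin1; have := mul_bin_diag M.+1 1.
  by rewrite bin1; nia.
by apply: leq_trans kt; rewrite leq_exp2l //; lia.
Qed.

(** * The two inequalities *)

Local Open Scope ring_scope.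

Lemma ceil_log_base (R : realType) (b : R) (x : nat) : 1 < b -> (1 < x)%N ->
  exists n : nat, [/\ Num.ceil (log_base b x%:R) = n%:Z, x%:R <= b ^+ n &
    b ^+ n.-1 < x%:R].
Proof.
move=> b1 x1; have b0 : 0 < b by apply: lt_trans b1.
have lnb : 0 < ln b by apply: ln_gt0.
have x0 : 0 < x%:R :> R by rewrite ltr0n ltnW.
have y0 : 0 < log_base b x%:R by rewrite divr_gt0 // ln_gt0 // ltr1n.
have /andP[lt_y y_le] := ceil_itv (log_base b x%:R).
have : 0 < Num.ceil (log_base b x%:R) by rewrite ceil_gt0.
case: (Num.ceil _) lt_y y_le => // -[//|n] lt_y y_le _; exists n.+1; split=> //.
- rewrite -ler_ln ?posrE ?exprn_gt0 // lnXn // -[ln b *+ _]mulr_natl.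
  by rewrite -ler_pdivrMr.
- rewrite -ltr_ln ?posrE ?exprn_gt0 // lnXn // -[ln b *+ _]mulr_natl -ltr_pdivlMr //.
  by move: lt_y; rewrite -[n.+1]addn1 PoszD addrK addn1.
Qed.

Theorem theorem3p12 (R : realType) (s r : nat)
    (hs : (2 <= s)%N) (hr : (2 <= r)%N) :
  exists BRdd BRdc : nat,
    is_BR2 (diamond s) (diamond r) BRdd /\
    is_BR2 (diamond s) (cup (s + r - 1)) BRdc /\
    BRdd%:Z <= BRdc%:Z + Num.ceil (log_base (2 : R) (2 * s + 2 * r)%:R) /\
    BRdc%:Z + Num.ceil (log_base (2 : R) (2 * s + 2 * r)%:R)
      <= 2 * Num.ceil (log_base (3 / 2 : R) (2 * r + 2 * s - 1)%:R).
Proof.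
set t := (s + r - 1)%N.
have two1 : 1 < 2 :> R by rewrite ltr1n.
have three_half1 : 1 < 3 / 2 :> R by rewrite ltr_pdivlMr ?ltr0n // mul1r ltr_nat.
have [k [-> le_k lt_k]] := ceil_log_base two1 (ltac:(lia) : (1 < 2 * s + 2 * r)%N).
have [m [-> le_m _]] :=
  ceil_log_base three_half1 (ltac:(lia) : (1 < 2 * r + 2 * s - 1)%N).
move: le_k lt_k; rewrite -!natrX ler_nat ltr_nat => le_k lt_k.
have le_m' : ((2 * t + 1) * 2 ^ m <= 3 ^ m)%N.
  rewrite -(ler_nat R) natrM !natrX -ler_pdivlMr ?exprn_gt0 ?ltr0n // -expr_div_n.
  by rewrite (_ : 2 * t + 1 = 2 * r + 2 * s - 1)%N // /t; lia.
have k2 : (2 < k)%N.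
  by rewrite ltnNge; apply/negP => k2; have := leq_pexp2l (isT : 0 < 2)%N k2; lia.
have expk : (2 ^ k = 2 * 2 ^ k.-1)%N by rewrite -expnS prednK //; lia.
have expk1 : (2 ^ k.-1 = 2 * 2 ^ (k - 2))%N.
  by rewrite -expnS; congr (2 ^ _)%N; lia.
(* If [m <= k], then [2t + 1 <= (3/2)^k], while [2^k <= 2(2t + 1)]; together [4^k <= 2 * 3^k], false
   for [k > 2]. *)
have km : (k < m)%N.
  rewrite ltnNge; apply/negP => mk; have := double_exp3_lt_exp4 k2.
  have : (3 ^ m * 2 ^ k <= 3 ^ k * 2 ^ m)%N.
    rewrite -(subnK mk) !expnD.
    rewrite (_ : 3 ^ m * _ = 3 ^ m * 2 ^ m * 2 ^ (k - m))%N; last by lia.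
    rewrite (_ : _ * 3 ^ m * _ = 3 ^ m * 2 ^ m * 3 ^ (k - m))%N; last by lia.
    by rewrite leq_mul2l; apply/orP; right; case: (k - m)%N => // d; rewrite leq_exp2r.
  have le_u : (2 ^ k <= 2 * (2 * t + 1))%N by rewrite /t; lia.
  have b0 : (0 < 2 ^ m)%N by rewrite expn_gt0.
  have := leq_mul (leq_mul le_u (leqnn (2 ^ m))) (leqnn (2 ^ k)).
  have := leq_mul le_m' (leqnn (2 ^ k)).
  move=> h1 h2 h3; rewrite -(ltn_pmul2r b0) => h4.
  by move: h1 h2 h3 h4; clear; lia.
have t2 : (2 < t)%N by rewrite /t; lia.
have kt : (2 ^ (k - 2) <= t)%N by rewrite /t; lia.
(* Passing from [m] to [m + 1] gains the factor 3/2 that lifts [2t + 1] above [2t + s - 1]; [k < m]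
   absorbs the extra dimension, as [m + 1 + k <= 2m]. *)
have ram_dc : boolean_ramsey (diamond s) (cup t) m.+1.
  apply: diamond_cup_ramsey; [by lia | by lia |].
  have b0 : (0 < 2 ^ m)%N by rewrite expn_gt0.
  have le_v : (2 * (t.*2 + s).-1 < 3 * (2 * t + 1))%N by rewrite /t; lia.
  rewrite -(ltn_pmul2r b0) in le_v.
  by rewrite !expnS; move: le_m' le_v; clear; lia.
have [BRdc BRdcP le_dc] := ex_BR2 ram_dc.
have gt_dc := cup_ramsey_gt k2 hs t2 kt (proj1 BRdcP).
have ram_dd : exists2 n, boolean_ramsey (diamond s) (diamond r) n & (n <= BRdc + k)%N.
  have sr : (s + r <= 2 ^ k.-1)%N by lia.
  have [k7|k7] := leqP k 7.
    exists k.*2.+1; last by lia.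
    exact: diamond_ramsey_small (introT andP (conj k2 k7)) hs hr sr.
  exists k.+1.*2; last by have := cup_ramsey_gt_succ k7 hs kt (proj1 BRdcP); lia.
  by apply: (diamond_ramsey_large _ hs hr); rewrite // subSS subn1.
have [n ram_n le_n] := ram_dd.
have [BRdd BRddP le_dd] := ex_BR2 ram_n.
exists BRdd, BRdc; split=> //; split=> //; split; lia.
Qed.
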